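(* In the setting described in the context, assume that the functions $F_{ij}$, $(i,j)\in\Sigma_N\times\Sigma_M$, satisfy the following matchable conditions: (1) for all $i\in\Sigma_{N-1}$, $j\in\Sigma_M$, with $x^*=u_i^{-1}(x_i)=u_{i+1}^{-1}(x_i)$, $$F_{ij}(x^*,y,z)=F_{i+1,j}(x^*,y,z)\quad\text{for all } y\in J'_j,\ z\in\mathbb{R};$$ (2) for all $i\in\Sigma_N$, $j\in\Sigma_{M-1}$, with $y^*=v_j^{-1}(y_j)=v_{j+1}^{-1}(y_j)$, $$F_{ij}(x,y^*,z)=F_{i,j+1}(x,y^*,z)\quad\text{for all } x\in I'_i,\ z\in\mathbb{R}.$$ Then there exists a unique continuous function $f:I\times J\to\mathbb{R}$ such that $f(x_i,y_j)=z_{ij}$ for all $i\in\Sigma_{N,0}$, $j\in\Sigma_{M,0}$, and $(\Gamma f|_{D_{ij}})_{1\le i\le N,1\le j\le M}$ is the invariant set of $W$, i.e. $\Gamma f|_{D_{ij}}=W_{ij}(\Gamma f|_{D'_{ij}})$ for all $(i,j)\in\Sigma_N\times\Sigma_M$.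
   Context: For a positive integer $n$, $\Sigma_n=\{1,\dots,n\}$ and $\Sigma_{n,0}=\{0,1,\dots,n\}$. Let $N,M\ge 2$ be integers and let $\{(x_i,y_j,z_{ij})\in\mathbb{R}^3: i\in\Sigma_{N,0}, j\in\Sigma_{M,0}\}$ be given with $x_0<x_1<\dots<x_N$ and $y_0<y_1<\dots<y_M$. Put $I=[x_0,x_N]$, $J=[y_0,y_M]$, $I_i=[x_{i-1},x_i]$, $J_j=[y_{j-1},y_j]$, $D_{ij}=I_i\times J_j$. Let $x'_0,\dots,x'_N$ be a finite sequence in $\{x_i: i\in\Sigma_{N,0}\}$ with $|x'_i-x'_{i-1}|>x_i-x_{i-1}$ for all $i\in\Sigma_N$, and let $y'_0,\dots,y'_M$ be a finite sequence in $\{y_j: j\in\Sigma_{M,0}\}$ with $|y'_j-y'_{j-1}|>y_j-y_{j-1}$ for all $j\in\Sigma_M$. Let $I'_i$ be the closed interval with endpoints $x'_{i-1},x'_i$, let $J'_j$ be the closed interval with endpoints $y'_{j-1},y'_j$, and $D'_{ij}=I'_i\times J'_j$. Let $u_i:I'_i\to I_i$ be a contractive homeomorphism (Lipschitz with constant $<1$) with $u_i(x'_{i-1})=x_{i-1}$, $u_i(x'_i)=x_i$, and $v_j:J'_j\to J_j$ a contractive homeomorphism with $v_j(y'_{j-1})=y_{j-1}$, $v_j(y'_j)=y_j$. For $i\in\Sigma_{N,0}$, $j\in\Sigma_{M,0}$, let $z'_{ij}$ denote the $z_{pq}$ with $x_p=x'_i$, $y_q=y'_j$. For each $(i,j)\in\Sigma_N\times\Sigma_M$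 let $F_{ij}:D'_{ij}\times\mathbb{R}\to\mathbb{R}$ be a continuous function such that $F_{ij}(x'_k,y'_\ell,z'_{k\ell})=z_{k\ell}$ for all $(k,\ell)\in\{i-1,i\}\times\{j-1,j\}$, and such that, for a constant $\alpha_{ij}\in(0,1)$, $|F_{ij}(x,y,z')-F_{ij}(x,y,z'')|\le\alpha_{ij}|z'-z''|$ for all $(x,y)\in D'_{ij}$ and $z',z''\in\mathbb{R}$. Define $W_{ij}:D'_{ij}\times\mathbb{R}\to D_{ij}\times\mathbb{R}$ by $W_{ij}(x,y,z)=(u_i(x),v_j(y),F_{ij}(x,y,z))$. For families $A=(A_{ij})$ of nonempty compact sets $A_{ij}\subset D_{ij}\times\mathbb{R}$, $W(A)$ is the family with $(W(A))_{ij}=\bigcup\{W_{ij}(A_{k\ell}): (k,\ell)\in\Sigma_N\times\Sigma_M,\ D_{k\ell}\subset D'_{ij}\}$. For a function $f$ on $I\times J$ and $E\subset I\times J$, $\Gamma f|_E=\{(x,y,f(x,y)):(x,y)\in E\}$. *)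

(* Defs.v *)
From HB Require Import structures.
From mathcomp Require Import all_boot all_order all_algebra.
From mathcomp Require Import all_classical all_reals all_analysis.
Set Implicit Arguments.
Unset Strict Implicit.
Unset Printing Implicit Defensive.
Import Order.TTheory GRing.Theory Num.Theory.
Import numFieldNormedType.Exports.
Local Open Scope classical_set_scope.
Local Open Scope ring_scope.

(* Nodes are indexed by 'I_n.+1 = {0, ..., n}. The element i : 'I_n stands for
   the cell number i + 1 in {1, ..., n}; its two nodes are [lo i] (number i)
   and [hi i] (number i + 1). *)
Definition lo (n : nat) (i : 'I_n) : 'I_n.+1 := widen_ord (leqnSn n) i.
Definition hi (n : nat) (i : 'I_n) : 'I_n.+1 := lift ord0 i.

Definition strictly_increasing (R : realType) (n : nat) (x : 'I_n.+1 -> R) :=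
  forall k l : 'I_n.+1, (k < l)%N -> x k < x l.

Definition whole (R : realType) (n : nat) (x : 'I_n.+1 -> R) : set R :=
  `[x ord0, x ord_max]%classic.

Definition cell (R : realType) (n : nat) (x : 'I_n.+1 -> R) (i : 'I_n) : set R :=
  `[x (lo i), x (hi i)]%classic.

(* Like [cell], for a sequence x' that need not be monotone. *)
Definition dcell (R : realType) (n : nat) (x' : 'I_n.+1 -> R) (i : 'I_n) : set R :=
  `[Num.min (x' (lo i)) (x' (hi i)), Num.max (x' (lo i)) (x' (hi i))]%classic.

Definition homeomorphism_on (R : realType) (A B : set R) (f : R -> R) :=
  [/\ {homo f : s / A s >-> B s}, {within A, continuous f} &
      exists g : R -> R,
        [/\ {homo g : t / B t >-> A t}, {within B, continuous g},
            (forall s, A s -> g (f s) = s) & (forall t, B t -> f (g t) = t)]].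

Definition contractive_on (R : realType) (A : set R) (f : R -> R) :=
  exists c : R, 0 <= c < 1 /\
    forall s t, A s -> A t -> `|f s - f t| <= c * `|s - t|.

Definition graph_on (R : realType) (f : R * R -> R) (E : set (R * R)) :
    set (R * R * R) :=
  [set (p, f p) | p in E].

Section RecurrentIFS.
Variables (R : realType) (N M : nat).
Variables (x x' : 'I_N.+1 -> R) (y y' : 'I_M.+1 -> R).
Variables (u : 'I_N -> R -> R) (v : 'I_M -> R -> R).
Variable F : 'I_N -> 'I_M -> R * R * R -> R.

Definition D (i : 'I_N) (j : 'I_M) : set (R * R) := cell x i `*` cell y j.

Definition D' (i : 'I_N) (j : 'I_M) : set (R * R) := dcell x' i `*` dcell y' j.

Definition Wmap (i : 'I_N) (j : 'I_M) (p : R * R * R) : R * R * R :=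
  (u i p.1.1, v j p.1.2, F i j p).

Definition Wop (A : 'I_N -> 'I_M -> set (R * R * R)) (i : 'I_N) (j : 'I_M) :
    set (R * R * R) :=
  \bigcup_(kl in [set kl : 'I_N * 'I_M | D kl.1 kl.2 `<=` D' i j])
    (Wmap i j @` A kl.1 kl.2).

Definition compact_family (A : 'I_N -> 'I_M -> set (R * R * R)) :=
  forall i j, [/\ A i j !=set0, compact (A i j) & A i j `<=` D i j `*` setT].

Definition invariant_family (A : 'I_N -> 'I_M -> set (R * R * R)) :=
  compact_family A /\ forall i j, Wop A i j = A i j.

End RecurrentIFS.

(* Main.v *)
Require Import Defs.
From HB Require Import structures.
From mathcomp Require Import all_boot all_order all_algebra.
From mathcomp Require Import all_classical all_reals all_analysis.
From mathcomp Require Import ring.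
Set Implicit Arguments.
Unset Strict Implicit.
Unset Printing Implicit Defensive.
Import Order.TTheory GRing.Theory Num.Theory.
Import numFieldNormedType.Exports.
Local Open Scope classical_set_scope.
Local Open Scope ring_scope.

(* The inverse branches of the u_i (resp. v_j) agree at the common nodes, so they
   glue to a continuous map psi of the rectangle into itself; by the matching
   conditions the F_ij glue likewise to a continuous G with
   G (p, t) = F_ij (psi p, t) for p in D_ij.  Invariance of the graph of f says
   exactly that f p = G (p, f (psi p)), a fixed point equation that is
   contractive because G is Lipschitz in t with constant max alpha_ij < 1. *)

(** * Continuity on subsets: composition, pairing, closed products *)

Lemma within_continuous_comp_sub (T U V : topologicalType) (A : set T) (B : set U)
    (f : T -> U) (g : U -> V) :
  {homo f : s / A s >-> B s} -> {within A, continuous f} ->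
  {within B, continuous g} -> {within A, continuous (g \o f)}.
Proof.
move=> AB /subspace_continuousP cf /subspace_continuousP cg.
apply/subspace_continuousP => s As.
move=> P /(cg _ (AB _ As)) /(cf _ As) H.
have {}H : \forall t \near s, A t -> B (f t) -> P (g (f t)) := H.
by apply: (@filterS _ (nbhs s) _ _ _ _ H) => t h At; exact/h/AB.
Qed.

Lemma within_continuous_pair (T U V : topologicalType) (A : set T)
    (f : T -> U) (g : T -> V) :
  {within A, continuous f} -> {within A, continuous g} ->
  {within A, continuous (fun s => (f s, g s))}.
Proof.
move=> /subspace_continuousP cf /subspace_continuousP cg.
by apply/subspace_continuousP => s As; apply: cvg_pair; [exact: cf|exact: cg].
Qed.

Lemma closed_prod (T U : topologicalType) (A : set T) (B : set U) :
  closed A -> closed B -> closed (A `*` B).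
Proof.
move=> cA cB.
have -> : A `*` B = (fst @^-1` A) `&` (snd @^-1` B) by [].
by apply: closedI; apply: preimage_closed => // -[s t] _; [exact: cvg_fst|exact: cvg_snd].
Qed.

(** * Geometric estimates and contractive functional equations *)

Lemma eq0_le_geometric (R : realType) (B a r : R) :
  0 <= a < 1 -> (forall n, `|r| <= geometric B a n) -> r = 0.
Proof.
move=> /andP[a0 a1] rB; apply/eqP; rewrite -normr_le0.
have := @cvg_geometric R B a; rewrite ger0_norm// => /(_ a1) cB.
rewrite -(cvg_lim _ cB)//; apply: limr_ge; first by apply/cvg_ex; eexists; exact: cB.
exact: nearW.
Qed.

(* Iterating the inequality [n] times gives [`|d p| <= a ^+ n * B]. *)
Lemma contracted_eq0 (R : realType) (T : Type) (A : set T) (phi : T -> T)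
    (d : T -> R) (a B : R) :
  0 <= a < 1 -> {homo phi : p / A p >-> A p} ->
  (forall p, A p -> `|d p| <= B) ->
  (forall p, A p -> `|d p| <= a * `|d (phi p)|) ->
  forall p, A p -> d p = 0.
Proof.
move=> a01 Aphi dB dphi p Ap; have /andP[a0 _] := a01.
have dn n q : A q -> `|d q| <= geometric B a n.
  elim: n q => [|n IH] q Aq; first by rewrite /= expr0 mulr1 dB.
  apply: le_trans (dphi _ Aq) _; rewrite /= exprS mulrCA.
  by rewrite ler_wpM2l// IH//; exact: Aphi.
by apply: (eq0_le_geometric a01) => n; exact: dn.
Qed.

Lemma within_continuous_bounded (R : realType) (T : topologicalType) (K : set T)
    (f : T -> R) :
  compact K -> {within K, continuous f} ->
  exists B, 0 <= B /\ forall p, K p -> `|f p| <= B.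
Proof.
move=> cK cf.
have /compact_bounded [b [_ bK]] := continuous_compact cf cK.
exists (`|b| + 1); split; first by rewrite addr_ge0.
by move=> p Kp; apply: (bK (`|b| + 1)); [rewrite (le_lt_trans (ler_norm b))// ltrDl|exists p].
Qed.

(** Picard iteration from the zero function: the iterates are bounded on [K] by one [B] and their
    tails by [B * a ^+ n], so they converge uniformly on [K] and the limit inherits continuity. *)
Lemma contraction_equation_continuous_solution (R : realType) (T : topologicalType) (K : set T)
    (psi : T -> T) (G : T * R -> R) (a : R) :
  compact K -> 0 <= a < 1 -> {homo psi : p / K p >-> K p} ->
  {within K, continuous psi} -> {within K `*` setT, continuous G} ->
  (forall p, K p -> forall s t, `|G (p, s) - G (p, t)| <= a * `|s - t|) ->
  exists f : T -> R, {within K, continuous f} /\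
    forall p, K p -> f p = G (p, f (psi p)).
Proof.
move=> cK a01 Kpsi cpsi cG Glip.
have /andP[a0 a1] := a01.
have cst0 : {within K, continuous (fun _ : T => 0 : R)}.
  by apply: continuous_subspaceT => ?; exact: cvg_cst.
have cstep f : {within K, continuous f} ->
    {within K, continuous (fun p => G (p, f (psi p)))}.
  move=> cf; apply: (@within_continuous_comp_sub _ _ _ _ (K `*` setT)
    (fun p => (p, f (psi p))) G) => //.
  apply: within_continuous_pair; first by apply: continuous_subspaceT => ?; exact: cvg_id.
  exact: (within_continuous_comp_sub Kpsi cpsi cf).
have [C [C0 GC]] := within_continuous_bounded cK (cstep _ cst0).
(* [C] bounds [|G (p, 0)|] on [K], and [B] solves [C + a * B = B], so the bound [B] survives each
   iteration. *)
pose B := C / (1 - a).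
have B0 : 0 <= B by rewrite divr_ge0// subr_ge0 ltW.
have BE : C + a * B = B by rewrite /B; field; rewrite subr_eq0 gt_eqF.
pose fn n := iter n (fun f p => G (p, f (psi p))) (fun _ => 0 : R).
have fn_cont n : {within K, continuous (fn n)}.
  by elim: n => [//|n IH]; exact: cstep.
have fnB n p : K p -> `|fn n p| <= B.
  elim: n p => [|n IH] p Kp; first by rewrite normr0.
  have -> : fn n.+1 p = (G (p, fn n (psi p)) - G (p, 0)) + G (p, 0) by rewrite subrK.
  rewrite (le_trans (ler_normD _ _))// -BE addrC lerD ?GC//.
  rewrite (le_trans (Glip _ Kp _ _))// subr0 ler_wpM2l// IH//; exact: Kpsi.
(* Unfolding [n] steps of both iterates leaves [fn m] against the zero function; the bound is
   therefore uniform in [m]. *)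
have fn_tail n m p : K p -> `|fn (n + m)%N p - fn n p| <= geometric B a n.
  elim: n p => [|n IH] p Kp; first by rewrite /= subr0 mulr1 fnB.
  rewrite (le_trans (Glip _ Kp _ _))//= exprS mulrCA ler_wpM2l//.
  by apply: IH; exact: Kpsi.
have geo0 : geometric B a x @[x --> \oo] --> 0.
  by apply: cvg_geometric; rewrite ger0_norm.
have fn_cvg p : K p -> cvgn (fn ^~ p).
  move=> Kp; apply/cauchy_cvgP/cauchyP => e e0.
  have /cvgrPdist_lt/(_ _ e0) [n _ Hn] := geo0.
  exists (fn n p); exists n => // m /= nm; rewrite /ball /= distrC -(subnKC nm).
  apply: le_lt_trans (fn_tail _ _ _ Kp) _.
  by have := Hn n (leqnn n); rewrite /= sub0r normrN; exact/le_lt_trans/ler_norm.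
pose f p := limn (fn ^~ p).
have f_tail n p : K p -> `|f p - fn n p| <= geometric B a n.
  move=> Kp.
  have h : `|fn m p - fn n p| @[m --> \oo] --> `|f p - fn n p|.
    by apply: cvg_norm; apply: cvgB; [exact: fn_cvg|exact: cvg_cst].
  rewrite -(cvg_lim _ h)//; apply: limr_le; first by apply/cvg_ex; eexists; exact: h.
  by exists n => // m /= nm; rewrite -(subnKC nm) fn_tail.
exists f; split.
  apply: (@uniform_limit_continuous_subspace _ R K (fn @ \oo) f).
    by exists 0%N => // n _; exact: fn_cont.
  move=> P /uniform_nbhs [E [/= entE EP]].
  have [e e0 eE] : exists2 e : R, 0 < e & forall s t : R, `|s - t| < e -> E (s, t).
    move: entE; rewrite -entourage_ballE.
    by case=> e /= e0 eE; exists e => // s t st; apply: (eE (s, t)).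
  have /cvgrPdist_lt/(_ _ e0) [n _ Hn] := geo0.
  exists n => // m /= /Hn /= h; apply: EP => /= p Kp; apply: eE.
  apply: le_lt_trans (f_tail _ _ Kp) _.
  by rewrite sub0r normrN in h; exact: le_lt_trans (ler_norm _) h.
move=> p Kp; apply/eqP; rewrite -subr_eq0; apply/eqP.
(* Comparison through [fn n.+1]: its distance to [f] costs [B * a ^+ n.+1], and replacing [fn n] by
   [f] inside [G] costs [a * (B * a ^+ n)]. *)
apply: (@eq0_le_geometric _ (a * (B + B)) a) => // n.
have -> : f p - G (p, f (psi p)) =
  (f p - fn n.+1 p) + (G (p, fn n (psi p)) - G (p, f (psi p))).
  by rewrite addrA subrK.
have -> : geometric (a * (B + B)) a n =
    geometric B a n.+1 + a * geometric B a n by rewrite /= exprS; ring.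
rewrite (le_trans (ler_normD _ _))// lerD ?f_tail//.
rewrite (le_trans (Glip _ Kp _ _))// ler_wpM2l// distrC f_tail//; exact: Kpsi.
Qed.

(** * Pasting over finite closed covers *)

Lemma within_continuous_cover (I : finType) (T U : topologicalType)
    (A : I -> set T) (K : set T) (f : T -> U) :
  (forall i, closed (A i)) -> (forall i, {within A i, continuous f}) ->
  (forall p, K p -> exists i, A i p) -> {within K, continuous f}.
Proof.
(* Pasting two pieces uses that both are closed, so the induction on the list of indices carries
   closedness of the partial union along with continuity. *)
move=> cA cf KA; pose AU (s : seq I) := [set p | exists2 i, i \in s & A i p].
have [_ H] : closed (AU (enum I)) /\ {within AU (enum I), continuous f}.
  elim: (enum I) => [|i s [cs cfs]].
    have -> : AU [::] = set0 by rewrite -subset0 => p [].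
    by split; [exact: closed0|apply/subspace_continuousP].
  have -> : AU (i :: s) = A i `|` AU s.
    apply/seteqP; split=> p.
      by case=> j; rewrite inE => /predU1P[->|js] Aj; [left|right; exists j].
    case=> [Ai|[j js Aj]]; first by exists i => //; rewrite mem_head.
    by exists j => //; rewrite inE js orbT.
  by split; [exact: closedU|exact: withinU_continuous].
apply: continuous_subspaceW H => p /KA [i Aip].
by exists i => //; rewrite mem_enum.
Qed.

Lemma itvccE (R : realType) (a b s : R) : `[a, b]%classic s = (a <= s <= b).
Proof. by rewrite /= in_itv. Qed.

(** * Subdivisions of an interval, their cells and the inverse branches *)

Section Nodes.
Variables (R : realType) (n : nat) (x : 'I_n.+1 -> R).
Hypothesis hx : strictly_increasing x.

Lemma nodes_le (k l : 'I_n.+1) : (k <= l)%N -> x k <= x l.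
Proof.
rewrite leq_eqVlt => /predU1P[/val_inj ->//|/hx]; exact: ltW.
Qed.

Lemma nodes_ltE (k l : 'I_n.+1) : x k < x l -> (k < l)%N.
Proof. by move=> h; rewrite ltnNge; apply/negP => /nodes_le; rewrite leNgt h. Qed.

Lemma lo_succ (i i1 : 'I_n) : i1 = i.+1 :> nat -> lo i1 = hi i.
Proof. by move=> h; apply: val_inj; rewrite /= h. Qed.

Lemma lo_or_hi (hn : (0 < n)%N) (k : 'I_n.+1) :
  exists i : 'I_n, k \in [:: lo i; hi i].
Proof.
have [kn|nk] := ltnP k n.
  by exists (Ordinal kn); rewrite !inE -val_eqE /= eqxx.
have hp : (n.-1 < n)%N by rewrite prednK.
exists (Ordinal hp); rewrite !inE -!val_eqE /= /bump /= add1n prednK//.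
by rewrite (_ : k == n :> nat) ?orbT// eqn_leq nk -ltnS ltn_ord.
Qed.

Lemma cell_lo i : cell x i (x (lo i)).
Proof. by rewrite /cell itvccE lexx nodes_le//= leqW. Qed.

Lemma cell_hi i : cell x i (x (hi i)).
Proof. by rewrite /cell itvccE lexx nodes_le//= leqW. Qed.

(** Induction on [l], peeling off the last cell. The index bounds keep the cell found between [x k]
    and [x l], which [dcell_cover] needs. *)
Lemma cell_cover (k l : 'I_n.+1) (s : R) : (k < l)%N -> x k <= s <= x l ->
  exists i, [/\ (k <= lo i)%N, (hi i <= l)%N & cell x i s].
Proof.
case: l => m hm /=; elim: m hm => [//|m IH] hm km /andP[ks sl].
pose i : 'I_n := Ordinal (hm : (m < n)%N).
have hiE : hi i = Ordinal hm by exact: val_inj.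
have [sm|ms] := leP s (x (lo i)); last first.
  by exists i; rewrite /cell itvccE hiE sl (ltW ms) /= -ltnS; split.
move: km; rewrite ltnS leq_eqVlt => /predU1P[ke|km].
  have ek : k = lo i by exact: val_inj.
  rewrite ek in ks *.
  by exists i; rewrite /cell itvccE hiE ks sl; split.
have [|j [kj jm js]] := IH (ltn_ord (lo i)) km.
  by rewrite ks (le_trans sm)// nodes_le.
by exists j; split => //; rewrite (leq_trans jm).
Qed.

Lemma cell_whole i : cell x i `<=` whole x.
Proof.
move=> s; rewrite /cell /whole !itvccE => /andP[ls sh].
by rewrite (le_trans _ ls) ?nodes_le// (le_trans sh)// nodes_le// -ltnS ltn_ord.
Qed.

Lemma whole_cell (hn : (0 < n)%N) s : whole x s -> exists i, cell x i s.
Proof.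
rewrite /whole itvccE => /(@cell_cover ord0 ord_max s hn) [i [_ _ si]].
by exists i.
Qed.

(** The chain [s <= x (hi i) <= x (lo i1) <= s] collapses, and strict monotonicity then leaves no
    room between the two cells. Pieces to be glued thus need comparing only at the common node of
    consecutive cells. *)
Lemma cell_inter (i i1 : 'I_n) s : (i < i1)%N -> cell x i s -> cell x i1 s ->
  i1 = i.+1 :> nat /\ s = x (hi i).
Proof.
move=> ii1; rewrite /cell !itvccE => /andP[_ si] /andP[i1s _].
have h : (hi i <= lo i1)%N by [].
have es : s = x (hi i).
  by apply/le_anti; rewrite si (le_trans (nodes_le h)).
split=> //; apply/eqP; rewrite eqn_leq ii1 andbT leqNgt; apply/negP => lt.
have /hx : (hi i < lo i1)%N by [].
by rewrite -es ltNge i1s.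
Qed.

Variables x' : 'I_n.+1 -> R.
Hypothesis hx' : forall k, exists p, x' k = x p.
Hypothesis hx'_lt :
  forall i : 'I_n, `|x' (hi i) - x' (lo i)| > x (hi i) - x (lo i).

(** The expansion condition excludes [x' (lo i) = x' (hi i)], because cells have nonnegative length;
    the two endpoints are then distinct nodes, in either order. *)
Lemma dcellE i : exists k l : 'I_n.+1, (k < l)%N /\ dcell x' i = `[x k, x l]%classic.
Proof.
have [k ek] := hx' (lo i); have [l el] := hx' (hi i).
have : x k != x l.
  rewrite -ek -el; apply/eqP => e; have := hx'_lt i.
  rewrite e subrr normr0 subr_lt0 ltNge nodes_le//=; exact: leqW.
rewrite /dcell ek el; case: ltgtP => // h _.
- by exists k, l; split => //; exact: nodes_ltE.
- by exists l, k; split => //; exact: nodes_ltE.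
Qed.

Lemma dcell_nodes i k : k \in [:: lo i; hi i] -> dcell x' i (x' k).
Proof.
rewrite !inE /dcell itvccE => /pred2P[]->;
by rewrite ge_min le_max !lexx ?orbT.
Qed.

Lemma dcell_whole i : dcell x' i `<=` whole x.
Proof.
have [k [l [_ ->]]] := dcellE i => s; rewrite /whole !itvccE => /andP[ks sl].
by rewrite (le_trans _ ks) ?nodes_le// (le_trans sl)// nodes_le// -ltnS ltn_ord.
Qed.

Lemma dcell_cover i s : dcell x' i s ->
  exists k, cell x k s /\ cell x k `<=` dcell x' i.
Proof.
have [k [l [kl ->]]] := dcellE i; rewrite itvccE => /(cell_cover kl) [j [kj jl js]].
exists j; split => // t; rewrite /cell !itvccE => /andP[jt tj].
by rewrite (le_trans _ jt) ?nodes_le// (le_trans tj)// nodes_le.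
Qed.

(** By the endpoint conditions, the inverses of two consecutive [u i] both send the common node to
    the same [x'] value. They therefore agree on overlaps and paste over the finitely many closed
    cells. *)
Lemma inverse_branches (u : 'I_n -> R -> R) :
  (0 < n)%N ->
  (forall i, homeomorphism_on (dcell x' i) (cell x i) (u i)) ->
  (forall i, u i (x' (lo i)) = x (lo i)) ->
  (forall i, u i (x' (hi i)) = x (hi i)) ->
  exists g : R -> R, [/\ {within whole x, continuous g},
    (forall i, {homo g : s / cell x i s >-> dcell x' i s}),
    (forall i s, cell x i s -> u i (g s) = s) &
    (forall i s, dcell x' i s -> g (u i s) = s)].
Proof.
move=> hn hu ulo uhi.
have /choice [g hg] : forall i, exists g : R -> R,
    [/\ {homo g : t / cell x i t >-> dcell x' i t}, {within cell x i, continuous g},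
    (forall s, dcell x' i s -> g (u i s) = s) & (forall t, cell x i t -> u i (g t) = t)].
  by move=> i; have [_ _ [g]] := hu i; exists g.
have g_succ (i i1 : 'I_n) s : (i < i1)%N -> cell x i s -> cell x i1 s -> g i s = g i1 s.
  move=> ii1 si si1; have [i1E ->] := cell_inter ii1 si si1.
  have [_ _ gK _] := hg i; have [_ _ gK1 _] := hg i1.
  rewrite -{1}uhi gK; last by apply: dcell_nodes; rewrite !inE eqxx orbT.
  rewrite -(lo_succ i1E) -ulo gK1//.
  by apply: dcell_nodes; rewrite !inE eqxx.
have g_eq i i1 s : cell x i s -> cell x i1 s -> g i s = g i1 s.
  move=> si si1; case: (ltngtP i i1) => [lt|lt|/val_inj ->//]; first exact: g_succ.
  by rewrite (g_succ _ _ _ lt).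
(* An arbitrary cell containing [s], with the first cell as default off the interval; [g_eq] makes
   the choice immaterial. *)
have /choice [idx hidx] : forall s, exists i, whole x s -> cell x i s.
  move=> s; have [/(whole_cell hn) [i si]|ns] := pselect (whole x s); first by exists i.
  by exists (Ordinal hn).
pose G s := g (idx s) s.
have GE i s : cell x i s -> G s = g i s.
  by move=> si; apply: g_eq => //; apply/hidx/(cell_whole si).
have uh i s : dcell x' i s -> cell x i (u i s) by have [+ _ _] := hu i; exact.
exists G; split => [|i s si|i s si|i s si].
- apply: (within_continuous_cover (A := cell x)).
  + by move=> i; exact: itv_closed.
  + move=> i; apply: (@subspace_eq_continuous _ _ _ (g i)).
      by move=> s; rewrite inE => si; exact/esym/GE.
    by have [] := hg i.
  + by move=> s; exact: whole_cell.
- by rewrite (GE _ _ si); have [+ _ _ _] := hg i; exact.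
- by have [_ _ _ ugK] := hg i; rewrite (GE _ _ si) ugK.
- by have [_ _ gK _] := hg i; rewrite (GE i) ?gK//; exact: uh.
Qed.

End Nodes.

(** * Graphs over the cells and invariance under [Wop] *)

Section Graphs.
Variables (R : realType) (N M : nat).
Variables (x x' : 'I_N.+1 -> R) (y y' : 'I_M.+1 -> R).
Hypotheses (hx : strictly_increasing x) (hy : strictly_increasing y).
Hypothesis hx' : forall k, exists p, x' k = x p.
Hypothesis hy' : forall l, exists q, y' l = y q.
Hypothesis hx'_lt :
  forall i : 'I_N, `|x' (hi i) - x' (lo i)| > x (hi i) - x (lo i).
Hypothesis hy'_lt :
  forall j : 'I_M, `|y' (hi j) - y' (lo j)| > y (hi j) - y (lo j).

Lemma D_whole i j : D x y i j `<=` whole x `*` whole y.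
Proof. by move=> p [/(cell_whole hx) ? /(cell_whole hy) ?]. Qed.

Lemma D'_whole i j : D' x' y' i j `<=` whole x `*` whole y.
Proof.
by move=> p [/(dcell_whole hx hx' hx'_lt) ? /(dcell_whole hy hy' hy'_lt) ?].
Qed.

(** Each domain [D'] is the union of the cells it contains, so the pieces of graph collected by
    [Wop] make up the graph over all of [D']. *)
Lemma Wop_graph_on (u : 'I_N -> R -> R) (v : 'I_M -> R -> R)
    (F : 'I_N -> 'I_M -> R * R * R -> R) (f : R * R -> R) i j :
  Wop x x' y y' u v F (fun k l => graph_on f (D x y k l)) i j =
  Wmap u v F i j @` graph_on f (D' x' y' i j).
Proof.
apply/seteqP; split=> q.
  move=> [[k l] /= sub [_ [p pD <-] <-]].
  by exists (p, f p) => //; exists p => //; exact: sub.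
move=> [_ [p [px py] <-] <-].
have [k [kx kD]] := dcell_cover hx hx' hx'_lt px.
have [l [ly lD]] := dcell_cover hy hy' hy'_lt py.
exists (k, l) => /=; first by move=> r [/kD ? /lD ?].
by exists (p, f p) => //; exists p.
Qed.

Lemma compact_family_graph_on (f : R * R -> R) :
  {within whole x `*` whole y, continuous f} ->
  compact_family x y (fun i j => graph_on f (D x y i j)).
Proof.
move=> cf i j; split.
- exists ((x (lo i), y (lo j)), f (x (lo i), y (lo j))).
  by exists (x (lo i), y (lo j)) => //; split; exact: cell_lo.
- apply: continuous_compact; last first.
    by apply: compact_setX; exact: segment_compact.
  apply: within_continuous_pair.
    by apply: continuous_subspaceT => ?; exact: cvg_id.
  by apply: continuous_subspaceW cf; exact: D_whole.
- by move=> _ [p pD <-].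
Qed.

Lemma invariant_family_graph_on (u : 'I_N -> R -> R) (v : 'I_M -> R -> R)
    (F : 'I_N -> 'I_M -> R * R * R -> R) (f : R * R -> R) :
  {within whole x `*` whole y, continuous f} ->
  invariant_family x x' y y' u v F (fun i j => graph_on f (D x y i j)) <->
  forall i j, graph_on f (D x y i j) = Wmap u v F i j @` graph_on f (D' x' y' i j).
Proof.
move=> cf; split=> [[_ W] i j|W]; first by rewrite -Wop_graph_on W.
by split; [exact: compact_family_graph_on|move=> i j; rewrite Wop_graph_on -W].
Qed.

End Graphs.

(** Functions are total on [R * R], hence uniqueness is equality on [IJ]. The matching conditions
    describe the common preimage by its images under both neighbouring maps, avoiding a named
    inverse. The last conjunct justifies reading invariance as the graph equation. *)
Theorem theorem2p1 (R : realType) (N M : nat) (hN : (2 <= N)%N) (hM : (2 <= M)%N)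
  (x : 'I_N.+1 -> R) (y : 'I_M.+1 -> R) (z : 'I_N.+1 -> 'I_M.+1 -> R)
  (hx : strictly_increasing x) (hy : strictly_increasing y)
  (x' : 'I_N.+1 -> R) (y' : 'I_M.+1 -> R) (z' : 'I_N.+1 -> 'I_M.+1 -> R)
  (hx' : forall k, exists p, x' k = x p)
  (hy' : forall l, exists q, y' l = y q)
  (hx'_lt : forall i : 'I_N, `|x' (hi i) - x' (lo i)| > x (hi i) - x (lo i))
  (hy'_lt : forall j : 'I_M, `|y' (hi j) - y' (lo j)| > y (hi j) - y (lo j))
  (hz' : forall k l p q, x p = x' k -> y q = y' l -> z' k l = z p q)
  (u : 'I_N -> R -> R) (v : 'I_M -> R -> R)
  (hu_homeo : forall i, homeomorphism_on (dcell x' i) (cell x i) (u i))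
  (hu_contr : forall i, contractive_on (dcell x' i) (u i))
  (hu_lo : forall i, u i (x' (lo i)) = x (lo i))
  (hu_hi : forall i, u i (x' (hi i)) = x (hi i))
  (hv_homeo : forall j, homeomorphism_on (dcell y' j) (cell y j) (v j))
  (hv_contr : forall j, contractive_on (dcell y' j) (v j))
  (hv_lo : forall j, v j (y' (lo j)) = y (lo j))
  (hv_hi : forall j, v j (y' (hi j)) = y (hi j))
  (F : 'I_N -> 'I_M -> R * R * R -> R) (alpha : 'I_N -> 'I_M -> R)
  (hF_cont : forall i j, {within D' x' y' i j `*` [set: R], continuous (F i j)})
  (hF_interp : forall i j k l, k \in [:: lo i; hi i] -> l \in [:: lo j; hi j] ->
     F i j (x' k, y' l, z' k l) = z k l)
  (halpha : forall i j, 0 < alpha i j < 1)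
  (hF_lip : forall i j p, D' x' y' i j p -> forall t1 t2 : R,
     `|F i j (p, t1) - F i j (p, t2)| <= alpha i j * `|t1 - t2|)
  (hmatch_x : forall (i i1 : 'I_N) (j : 'I_M), i1 = i.+1 :> nat ->
     forall xs, dcell x' i xs -> u i xs = x (hi i) ->
       dcell x' i1 xs -> u i1 xs = x (hi i) ->
     forall s t, dcell y' j s -> F i j (xs, s, t) = F i1 j (xs, s, t))
  (hmatch_y : forall (i : 'I_N) (j j1 : 'I_M), j1 = j.+1 :> nat ->
     forall ys, dcell y' j ys -> v j ys = y (hi j) ->
       dcell y' j1 ys -> v j1 ys = y (hi j) ->
     forall s t, dcell x' i s -> F i j (s, ys, t) = F i j1 (s, ys, t)) :
  let IJ := whole x `*` whole y in
  let graphs (f : R * R -> R) := fun i j => graph_on f (D x y i j) in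
  let invariant (f : R * R -> R) := invariant_family x x' y y' u v F (graphs f) in
  let is_solution (f : R * R -> R) :=
    [/\ {within IJ, continuous f}, (forall k l, f (x k, y l) = z k l) &
        invariant f] in
  (exists f : R * R -> R, is_solution f /\
     forall g : R * R -> R, is_solution g -> forall p, IJ p -> g p = f p) /\
  (forall f : R * R -> R, {within IJ, continuous f} ->
     (invariant f <-> forall i j,
        graph_on f (D x y i j) = Wmap u v F i j @` graph_on f (D' x' y' i j))).
Proof.
move=> IJ graphs invariant is_solution.
have hN0 : (0 < N)%N by exact: ltnW.
have hM0 : (0 < M)%N by exact: ltnW.
have [gx [gx_cont gx_dcell ugx gxu]] :=
  inverse_branches hx hN0 hu_homeo hu_lo hu_hi.
have [gy [gy_cont gy_dcell vgy gyv]] :=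
  inverse_branches hy hM0 hv_homeo hv_lo hv_hi.
pose psi (p : R * R) := (gx p.1, gy p.2).
have psiD i j p : D x y i j p -> D' x' y' i j (psi p).
  by move=> [px py]; split; [exact: gx_dcell|exact: gy_dcell].
(* Again an arbitrary choice of cell with a default outside [IJ]; [GE] shows that [G] does not
   depend on it. *)
have /choice [idx idxD] : forall p : R * R, exists ij : 'I_N * 'I_M,
    IJ p -> D x y ij.1 ij.2 p.
  move=> p; have [[px py]|np] := pselect (IJ p).
    have [i pi] := whole_cell hx hN0 px; have [j pj] := whole_cell hy hM0 py.
    by exists (i, j).
  by exists (Ordinal hN0, Ordinal hM0).
have D_IJ i j p : D x y i j p -> IJ p by exact: D_whole.
have psi_IJ : {homo psi : p / IJ p >-> IJ p}.
  by move=> p /idxD /psiD; exact: (D'_whole hx hy hx' hy' hx'_lt hy'_lt).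
pose G (q : R * R * R) := F (idx q.1).1 (idx q.1).2 (psi q.1, q.2).
(* If the cells differ, [s] is the common node of two neighbours and [gx s] is the point x* of the
   matching condition. *)
have Fx i i1 j s t r : cell x i s -> cell x i1 s -> dcell y' j t ->
    F i j (gx s, t, r) = F i1 j (gx s, t, r).
  have succ (k k1 : 'I_N) : (k < k1)%N -> cell x k s -> cell x k1 s ->
      dcell y' j t -> F k j (gx s, t, r) = F k1 j (gx s, t, r).
    move=> kk1 sk sk1 jt; have [k1E sE] := cell_inter hx kk1 sk sk1.
    by apply: hmatch_x => //; rewrite -?sE; [exact: gx_dcell|exact: ugx
      |exact: gx_dcell|exact: ugx].
  move=> si si1 jt; case: (ltngtP i i1) => [lt|lt|/val_inj ->//]; first exact: succ.
  by rewrite -(succ _ _ lt).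
have Fy i j j1 s t r : cell y j t -> cell y j1 t -> dcell x' i s ->
    F i j (s, gy t, r) = F i j1 (s, gy t, r).
  have succ (k k1 : 'I_M) : (k < k1)%N -> cell y k t -> cell y k1 t ->
      dcell x' i s -> F i k (s, gy t, r) = F i k1 (s, gy t, r).
    move=> kk1 tk tk1 si; have [k1E tE] := cell_inter hy kk1 tk tk1.
    by apply: hmatch_y => //; rewrite -?tE; [exact: gy_dcell|exact: vgy
      |exact: gy_dcell|exact: vgy].
  move=> tj tj1 si; case: (ltngtP j j1) => [lt|lt|/val_inj ->//]; first exact: succ.
  by rewrite -(succ _ _ lt).
(* Up to four cells meet at a corner, so the indices are changed one at a time, through the cell
   [(i, (idx p).2)], which also contains [p]. *)
have GE i j p r : D x y i j p -> G (p, r) = F i j (psi p, r).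
  move=> pD; have [/= px py] := idxD _ (D_IJ _ _ _ pD).
  have [pi pj] := pD; rewrite /G /= /psi.
  by rewrite (Fx _ i) ?(Fy _ _ j)//; [exact: gx_dcell|exact: gy_dcell].
have psi_cont : {within IJ, continuous psi}.
  by apply: within_continuous_pair;
    [apply: (within_continuous_comp_sub (B := whole x) (f := fst)) gx_cont
    |apply: (within_continuous_comp_sub (B := whole y) (f := snd)) gy_cont];
    try (by move=> p []); apply: continuous_subspaceT => -[s t];
    [exact: cvg_fst|exact: cvg_snd].
have cont_fst3 (A : set (R * R * R)) : {within A, continuous fst}.
  by apply: continuous_subspaceT => -[s t]; exact: cvg_fst.
have cont_snd3 (A : set (R * R * R)) : {within A, continuous snd}.
  by apply: continuous_subspaceT => -[s t]; exact: cvg_snd.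
have G_cont : {within IJ `*` setT, continuous G}.
  apply: (within_continuous_cover
      (A := fun ij : 'I_N * 'I_M => D x y ij.1 ij.2 `*` setT)).
  - move=> ij; apply: closed_prod closedT.
    by apply: closed_prod; exact: itv_closed.
  - move=> [i j] /=.
    apply: (@subspace_eq_continuous _ _ _ (fun q => F i j (psi q.1, q.2))).
      by move=> [p r]; rewrite inE => -[pD _]; exact/esym/GE.
    apply: (within_continuous_comp_sub (B := D' x' y' i j `*` setT)
      (f := fun q : R * R * R => (psi q.1, q.2))) (hF_cont i j).
      by move=> q [qD _]; split => //; exact: psiD.
    apply: within_continuous_pair => //.
    apply: (within_continuous_comp_sub (B := IJ) (f := fst)) psi_cont => //.
    by move=> q [qD _]; exact: D_IJ qD.
  - by move=> [p r] [/idxD pD _]; exists (idx p).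
(* The base value 0 gives [0 <= a]; finiteness of the family keeps the maximum strictly below 1. *)
pose a : R := \big[Num.max/0]_(ij : 'I_N * 'I_M) alpha ij.1 ij.2.
have a01 : 0 <= a < 1.
  apply/andP; split; first exact: bigmax_ge_id.
  by apply: bigmax_lt => // ij _; have /andP[] := halpha ij.1 ij.2.
have G_lip p : IJ p -> forall s t, `|G (p, s) - G (p, t)| <= a * `|s - t|.
  move=> pIJ s t; rewrite (le_trans (hF_lip _ _ _ (psiD _ _ _ (idxD _ pIJ)) _ _))//.
  by rewrite ler_wpM2r// (le_bigmax _ (fun ij => alpha ij.1 ij.2)).
have K_compact : compact IJ by apply: compact_setX; exact: segment_compact.
(* [Wmap] sends the graph point over [psi p] to a point over [p] with height [G (p, f (psi p))];
   lying on the graph of [f] forces that height to be [f p]. *)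
have graphP f : (forall i j,
    graph_on f (D x y i j) = Wmap u v F i j @` graph_on f (D' x' y' i j)) <->
    forall p, IJ p -> f p = G (p, f (psi p)).
  split=> [W p pIJ|fix_f i j].
    have pD := idxD _ pIJ; have [px py] := pD.
    have : (Wmap u v F (idx p).1 (idx p).2 @`
        graph_on f (D' x' y' (idx p).1 (idx p).2))
        (Wmap u v F (idx p).1 (idx p).2 (psi p, f (psi p))).
      by exists (psi p, f (psi p)) => //; exists (psi p) => //; exact: psiD pD.
    rewrite -W => -[q _]; rewrite /Wmap /= ugx// vgy// => -[->].
    by rewrite -surjective_pairing.
  have Wpsi p : D x y i j p -> Wmap u v F i j (psi p, f (psi p)) = (p, f p).
    move=> pD; have [px py] := pD.
    rewrite /Wmap /= ugx// vgy// -(GE i j)// -fix_f -?surjective_pairing//.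
    exact: D_IJ pD.
  apply/seteqP; split=> [_ [p pD <-]|_ [_ [q [qx qy] <-] <-]].
    exists (psi p, f (psi p)); last exact: Wpsi.
    by exists (psi p) => //; exact: psiD.
  (* [psi] maps the cell onto [D']: any [q] there is [psi p] for this [p], so [Wpsi] also settles
     the reverse inclusion. *)
  pose p := (u i q.1, v j q.2).
  have pD : D x y i j p.
    have [uD _ _] := hu_homeo i; have [vD _ _] := hv_homeo j.
    by split; [exact: uD|exact: vD].
  have <- : psi p = q by rewrite /psi /= gxu// gyv// -surjective_pairing.
  by rewrite Wpsi//; exists p.
have invP f : {within IJ, continuous f} ->
    (invariant f <-> forall i j,
      graph_on f (D x y i j) = Wmap u v F i j @` graph_on f (D' x' y' i j)).
  exact: invariant_family_graph_on.
split=> //.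
have [f [f_cont f_fix]] :=
  contraction_equation_continuous_solution K_compact a01 psi_IJ psi_cont G_cont G_lip.
exists f; split.
  split => //; last by apply/invP => //; apply/graphP.
  have /choice [px hpx] := hx'; have /choice [py hpy] := hy'.
  (* The defect at the nodes is contracted along x'_k = x_(px k), y'_l = y_(py l),
     so every continuous solution of the fixed point equation interpolates. *)
  pose d (kl : 'I_N.+1 * 'I_M.+1) := f (x kl.1, y kl.2) - z kl.1 kl.2.
  suff d0 kl : d kl = 0 by move=> k l; apply/eqP; rewrite -subr_eq0; apply/eqP/(d0 (k, l)).
  (* There are finitely many nodes, so the sum of all defects bounds each one. *)
  apply: (@contracted_eq0 _ _ setT (fun kl => (px kl.1, py kl.2)) d a
    (\sum_kl `|d kl|)) => // {}kl _.
    by rewrite (bigD1 kl)//= lerDl sumr_ge0.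
  have [i ki] := lo_or_hi hN0 kl.1; have [j lj] := lo_or_hi hM0 kl.2.
  have xi : u i (x' kl.1) = x kl.1.
    by move: ki; rewrite !inE => /pred2P[]->.
  have yj : v j (y' kl.2) = y kl.2.
    by move: lj; rewrite !inE => /pred2P[]->.
  have pD : D x y i j (x kl.1, y kl.2).
    split => /=.
      by move: ki; rewrite !inE => /pred2P[]->; [exact: cell_lo|exact: cell_hi].
    by move: lj; rewrite !inE => /pred2P[]->; [exact: cell_lo|exact: cell_hi].
  have psiE : psi (x kl.1, y kl.2) = (x' kl.1, y' kl.2).
    by rewrite /psi /= -xi -yj gxu ?gyv//; exact: dcell_nodes.
  rewrite /d f_fix; last exact: D_IJ pD.
  (* Writing [z] at the node as a value of [F i j] too makes the defect a difference of [F i j] over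
     one base point, at heights [f] and [z] of the node [(px kl.1, py kl.2)]. *)
  rewrite (GE i j)// psiE -(hF_interp _ _ _ _ ki lj).
  rewrite (hz' _ _ _ _ (esym (hpx kl.1)) (esym (hpy kl.2))) hpx hpy.
  have D'p : D' x' y' i j (x (px kl.1), y (py kl.2)).
    by rewrite -hpx -hpy -psiE; exact: psiD.
  rewrite (le_trans (hF_lip _ _ _ D'p _ _))//.
  by rewrite ler_wpM2r// (le_bigmax _ (fun ij => alpha ij.1 ij.2) (i, j)).
(* Two solutions satisfy the same fixed point equation; their difference is bounded on the compact
   [IJ] and contracted along [psi], hence zero. *)
move=> g [g_cont _ /invP]/(_ g_cont)/graphP g_fix p pIJ.
apply/eqP; rewrite -subr_eq0; apply/eqP.
have [Bf [_ fB]] := within_continuous_bounded K_compact f_cont.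
have [Bg [_ gB]] := within_continuous_bounded K_compact g_cont.
apply: (@contracted_eq0 _ _ IJ psi (fun p => g p - f p) a (Bg + Bf)) => // q qIJ.
  by rewrite (le_trans (ler_normB _ _))// lerD ?fB ?gB.
by rewrite {1}g_fix// {1}f_fix// G_lip.
Qed.
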